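(* Let $\preceq_2'$ be the Dehornoy-like left-ordering on $\Gamma_2 = \langle a,b : b a^2 b = a\rangle$, and identify $\Gamma_2$ with the braid group $B_3 = \langle \sigma_1,\sigma_2 : \sigma_1\sigma_2\sigma_1 = \sigma_2\sigma_1\sigma_2\rangle$ via $a = \sigma_1\sigma_2$, $b = \sigma_2^{-1}$. Then $\preceq_2'$ coincides with the Dehornoy ordering $\preceq_D$ on $B_3$.
   Context: A left-ordering on a group is a total order invariant under left multiplication; its positive cone is the set of elements strictly bigger than the identity $id$, and it determines the ordering. For elements $g_1,\ldots,g_k$ of a group, $\langle g_1,\ldots,g_k\rangle^+$ denotes the semigroup they generate (all products of one or more of the $g_i$). The ordering $\preceq_2$ on $\Gamma_2$ is the left-ordering whose positive cone is $\langle a,b\rangle^+$ (this set is a positive cone because $\Gamma_2 = \langle a,b\rangle^+ \sqcup \langle a^{-1},b^{-1}\rangle^+ \sqcup \{id\}$). A subgroup $\Gamma_0$ of a left-ordered group $(\Gamma,\preceq)$ is $\preceq$-convex if $g \in \Gamma_0$ whenever $h_1 \prec g \prec h_2$ for some $h_1,h_2 \in \Gamma_0$. If $\Gamma_0$ is $\preceq$-convex and $\preceq'$ is a left-ordering on $\Gamma_0$, the extension of $\preceq'$ by $\preceq$ is the left-ordering on $\Gamma$ with positive cone $P^+_{\preceq'} \cup (P^+_{\preceq}\setminus \Gamma_0)$. The reverse ordering $\bar{\preceq}$ of $\preceq$ is the left-ordering for which $g$ is positive if and only if $g \prec id$. The subgroup $\langle b\rangle$ of $\Gamma_2$ is $\preceq_2$-convex,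 and the Dehornoy-like ordering $\preceq_2'$ is the extension of $\bar{\preceq}_2$ (restricted to $\langle b\rangle$) by $\preceq_2$; explicitly, its positive cone is $\{b^{-r} : r \geq 1\} \cup \big(\langle a,b\rangle^+ \setminus \langle b\rangle\big)$. The Dehornoy ordering: an element of $B_3$ is $1$-positive if it may be written as a word $\sigma_2^{n_0}\sigma_1\sigma_2^{n_1}\sigma_1\cdots\sigma_2^{n_{k-1}}\sigma_1\sigma_2^{n_k}$ with $k \geq 1$ and $n_i \in \mathbb{Z}$; it is $2$-positive if it equals $\sigma_2^n$ for some $n > 0$; it is $D$-positive if it is $1$-positive or $2$-positive. The Dehornoy ordering $\preceq_D$ is the left-ordering on $B_3$ whose positive cone is the set of $D$-positive elements. *)

(* Defs.v *)
From HB Require Import structures.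
From mathcomp Require Import all_boot ssralg ssrint generic_quotient.
From mathcomp Require Import boolp classical_sets.

Set Implicit Arguments.
Unset Strict Implicit.
Unset Printing Implicit Defensive.

Local Open Scope classical_set_scope.
Local Open Scope group_scope.
Local Open Scope quotient_scope.

(* The letter (i, false) stands for the generator x_i and
   (i, true) for its inverse; R u v is the defining relation u = v. *)

Section Presentation.
Variable I : choiceType.

Definition word := seq (I * bool).

Implicit Types u v w : word.

Definition inv_word u : word := rev [seq (x.1, ~~ x.2) | x <- u].

Inductive word_cong (R : word -> word -> Prop) : word -> word -> Prop :=
| WC_rel u v : R u v -> word_cong R u v
| WC_cancel (i : I) (e : bool) : word_cong R [:: (i, e); (i, ~~ e)] [::]
| WC_refl u : word_cong R u u
| WC_sym u v : word_cong R u v -> word_cong R v u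
| WC_trans u v w : word_cong R u v -> word_cong R v w -> word_cong R u w
| WC_cat u u' v v' :
    word_cong R u u' -> word_cong R v v' -> word_cong R (u ++ v) (u' ++ v').

Variable R : word -> word -> Prop.

Definition word_congb : rel word := fun u v => `[< word_cong R u v >].

Lemma word_congb_refl : reflexive word_congb.
Proof. by move=> u; apply/asboolP; apply: WC_refl. Qed.

Lemma word_congb_sym : symmetric word_congb.
Proof. by move=> u v; apply/asboolP/asboolP; apply: WC_sym. Qed.

Lemma word_congb_trans : transitive word_congb.
Proof.
move=> v u w /asboolP uv /asboolP vw; apply/asboolP.
exact: WC_trans uv vw.
Qed.

Canonical word_congb_equiv :=
  EquivRel word_congb word_congb_refl word_congb_sym word_congb_trans.

Definition presented := {eq_quot word_congb}.

HB.instance Definition _ := Choice.on presented.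
HB.instance Definition _ := EqQuotient.on presented.

Definition pres_class (u : word) : presented := \pi_presented u.

Lemma pres_classP u v : pres_class u = pres_class v <-> word_cong R u v.
Proof. by split=> [/eqquotP/asboolP|uv] //; apply/eqquotP/asboolP. Qed.

Lemma word_cong_repr u : word_cong R (repr (pres_class u)) u.
Proof. by apply/pres_classP; rewrite /pres_class reprK. Qed.

Definition pres_mul (x y : presented) := pres_class (repr x ++ repr y).
Definition pres_inv (x : presented) := pres_class (inv_word (repr x)).

Lemma pres_mulE u v :
  pres_mul (pres_class u) (pres_class v) = pres_class (u ++ v).
Proof. by apply/pres_classP; apply: WC_cat; apply: word_cong_repr. Qed.

Lemma pres_ind (P : presented -> Prop) :
  (forall u, P (pres_class u)) -> forall x, P x.
Proof. by move=> Pu x; rewrite -[x]reprK; apply: Pu. Qed.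

Lemma cat_inv_word u : word_cong R (u ++ inv_word u) [::].
Proof.
elim: u => [|[i e] u IHu]; first exact: WC_refl.
rewrite /inv_word /= rev_cons -cats1 -/(inv_word u).
rewrite catA -cat1s.
apply: WC_trans (WC_cancel R i e).
rewrite -[X in word_cong _ _ X]/([:: (i, e)] ++ ([::] ++ [:: (i, ~~ e)])).
by apply: WC_cat (WC_refl _ _) (WC_cat IHu (WC_refl _ _)).
Qed.

Lemma inv_wordK : involutive inv_word.
Proof.
move=> u; rewrite /inv_word map_rev revK -map_comp.
by rewrite -[RHS]map_id; apply: eq_map => -[i e] /=; rewrite negbK.
Qed.

Lemma inv_word_cong u v :
  word_cong R u v -> word_cong R (inv_word u) (inv_word v).
Proof.
move=> uv.
apply: (@WC_trans _ _ (inv_word u ++ (v ++ inv_word v))).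
  rewrite -[X in word_cong _ X _]cats0.
  by apply: WC_cat (WC_refl _ _) (WC_sym (cat_inv_word v)).
rewrite catA -[X in word_cong _ _ X]cat0s.
apply: WC_cat (WC_refl _ _).
apply: WC_trans (WC_cat (WC_refl _ _) (WC_sym uv)) _.
by rewrite -{2}[u]inv_wordK; apply: cat_inv_word.
Qed.

Lemma pres_invE u : pres_inv (pres_class u) = pres_class (inv_word u).
Proof. by apply/pres_classP/inv_word_cong/word_cong_repr. Qed.

Lemma pres_mulA : associative pres_mul.
Proof.
elim/pres_ind=> u; elim/pres_ind=> v; elim/pres_ind=> w.
by rewrite !pres_mulE catA.
Qed.

Lemma pres_1mul : left_id (pres_class [::]) pres_mul.
Proof. by elim/pres_ind=> u; rewrite pres_mulE. Qed.

Lemma pres_mul1 : right_id (pres_class [::]) pres_mul.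
Proof. by elim/pres_ind=> u; rewrite pres_mulE cats0. Qed.

Lemma pres_mulV : right_inverse (pres_class [::]) pres_inv pres_mul.
Proof.
elim/pres_ind=> u; rewrite pres_invE pres_mulE.
exact/pres_classP/cat_inv_word.
Qed.

Lemma pres_Vmul : left_inverse (pres_class [::]) pres_inv pres_mul.
Proof.
elim/pres_ind=> u; rewrite pres_invE pres_mulE -{2}[u]inv_wordK.
exact/pres_classP/cat_inv_word.
Qed.

HB.instance Definition _ := isGroup.Build presented
  pres_mulA pres_1mul pres_mul1 pres_Vmul pres_mulV.

Definition pres_gen (i : I) : presented := pres_class [:: (i, false)].

End Presentation.

Definition zpow (G : groupType) (x : G) (n : int) : G :=
  match n with Posz m => x ^+ m | Negz m => x ^- m.+1 end.

Definition cyclic_sub (G : groupType) (x : G) : set G :=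
  [set g | exists n : int, g = zpow x n].

Inductive semigroup_gen (G : groupType) (S : set G) : set G :=
| SG_gen g : S g -> semigroup_gen S g
| SG_mul g h : semigroup_gen S g -> semigroup_gen S h ->
    semigroup_gen S (g * h).

Section LeftOrderings.
Variable G : groupType.
Implicit Types (R : G -> G -> Prop) (P H : set G).

Definition strict R : G -> G -> Prop := fun g h => R g h /\ g <> h.

Record left_ordering R : Prop := LeftOrdering {
  lo_refl : forall g, R g g;
  lo_anti : forall g h, R g h -> R h g -> g = h;
  lo_trans : forall g h k, R g h -> R h k -> R g k;
  lo_total : forall g h, R g h \/ R h g;
  lo_mul : forall f g h, R g h -> R (f * g) (f * h)
}.

Definition positive_cone R : set G := [set g | strict R 1 g].

Definition left_ordering_with_cone R P : Prop :=
  left_ordering R /\ positive_cone R = P.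

(* The relation with positive cone P; it is a left-ordering only for suitable
   P. *)
Definition order_of_cone P : G -> G -> Prop :=
  fun g h => g = h \/ P (g^-1 * h).

Definition convex R H : Prop :=
  forall h1 g h2, H h1 -> H h2 -> strict R h1 g -> strict R g h2 -> H g.

Definition reverse R : G -> G -> Prop :=
  order_of_cone [set g | strict R g 1].

(* Extension by R of the ordering R' of the subgroup H; only the values of R'
   on H matter. *)
Definition extension H R' R : G -> G -> Prop :=
  order_of_cone ((positive_cone R' `&` H) `|` (positive_cone R `\` H)).

End LeftOrderings.

(* In both groups the first generator is indexed by true, the second by
   false. *)

Definition Gamma2_rel (u v : word bool) : Prop :=
  u = [:: (false, false); (true, false); (true, false); (false, false)] /\
  v = [:: (true, false)].

Definition Gamma2 : groupType := presented Gamma2_rel.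

Definition a : Gamma2 := pres_gen Gamma2_rel true.
Definition b : Gamma2 := pres_gen Gamma2_rel false.

Definition B3_rel (u v : word bool) : Prop :=
  u = [:: (true, false); (false, false); (true, false)] /\
  v = [:: (false, false); (true, false); (false, false)].

Definition B3 : groupType := presented B3_rel.

Definition sigma1 : B3 := pres_gen B3_rel true.
Definition sigma2 : B3 := pres_gen B3_rel false.

Definition preceq2 : Gamma2 -> Gamma2 -> Prop :=
  order_of_cone (semigroup_gen [set a; b]).

Definition preceq2' : Gamma2 -> Gamma2 -> Prop :=
  extension (cyclic_sub b) (reverse preceq2) preceq2.

Definition preceq2'_cone : set Gamma2 :=
  [set g | exists2 r : nat, (1 <= r)%N & g = b ^- r] `|`
  (semigroup_gen [set a; b] `\` cyclic_sub b).

(* ns lists n_1, ..., n_k. *)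
Definition one_positive : set B3 :=
  [set g | exists (n0 : int) (ns : seq int), (1 <= size ns)%N /\
     g = zpow sigma2 n0 * \prod_(n <- ns) (sigma1 * zpow sigma2 n)].

Definition two_positive : set B3 :=
  [set g | exists2 n : nat, (0 < n)%N & g = sigma2 ^+ n].

Definition D_positive : set B3 := one_positive `|` two_positive.

Definition preceqD : B3 -> B3 -> Prop := order_of_cone D_positive.

(* Main.v *)
Require Import Defs.
From HB Require Import structures.
From mathcomp Require Import all_boot order ssralg ssrnum ssrint rat.
From mathcomp Require Import ring lra zify.
From mathcomp Require Import boolp classical_sets.

Local Open Scope classical_set_scope.
Local Open Scope group_scope.

(** Gamma2 acts on the universal cover of the rational projective line so that
    [b] fixes a base point while [a] moves the base point, and keeps everything
    above it, strictly above it. Hence a word in [a] and powers of [b] that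
    contains [a] (but not its inverse) moves the base point up and is not a
    power of [b]. Conversely, [a^3] is central, and modulo its powers every
    element is [a^i m a^j] with [m] free of [b a^2 b]; such an element is a
    product of [a]'s and [b]'s or of their inverses. So the 1-positive elements
    are exactly the elements of [<a, b>^+] that are not powers of [b]. As
    [(x, y) |-> (x y, y^-1)] is an involution preserving 1-positivity, the
    isomorphism with B3 matches the two cones. *)

(** * Actions and morphisms of presented groups *)

Section PresentedGroups.
Context {I : choiceType} {R : word I -> word I -> Prop}.

Lemma pres_class_cat u v :
  pres_class R (u ++ v) = pres_class R u * pres_class R v.
Proof. by rewrite -pres_mulE. Qed.

Lemma pres_gen_inv i : (pres_gen R i)^-1 = pres_class R [:: (i, true)].
Proof. exact: (pres_invE R [:: (i, false)]). Qed.

Lemma pres_gen_ind (Q : presented R -> Prop) :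
    Q 1 -> (forall i g, Q g -> Q (pres_gen R i * g)) ->
    (forall i g, Q g -> Q ((pres_gen R i)^-1 * g)) ->
  forall g, Q g.
Proof.
move=> Q1 QM QV; elim/pres_ind; elim=> [|[i []] u IHu] //.
  by rewrite -cat1s pres_class_cat -pres_gen_inv; apply: QV.
by rewrite -cat1s pres_class_cat; apply: QM.
Qed.

Section Action.
Context {T : Type}.
Variable f : I * bool -> T -> T.
Hypothesis fK : forall i e t, f (i, e) (f (i, ~~ e) t) = t.
Hypothesis fR : forall u v, R u v -> forall t, foldr f t u = foldr f t v.

(** By [fK] cancelling pairs act trivially and by [fR] both sides of a relation act alike, so every
    word for [g] gives the same map. *)
Definition pres_act (g : presented R) (t : T) : T := foldr f t (repr g).

Lemma word_cong_act u v : word_cong R u v ->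
  forall t, foldr f t u = foldr f t v.
Proof.
elim=> {u v}
  [u v /fR //|i e|u|u v _ IH|u v w _ IH1 _ IH2|u u' v v' _ IH1 _ IH2] t //=.
- by rewrite IH1.
- by rewrite !foldr_cat IH2 IH1.
Qed.

Lemma pres_act_class u t : pres_act (pres_class R u) t = foldr f t u.
Proof. exact/word_cong_act/word_cong_repr. Qed.

Lemma pres_act1 t : pres_act 1 t = t.
Proof. exact: pres_act_class. Qed.

Lemma pres_actM g h t : pres_act (g * h) t = pres_act g (pres_act h t).
Proof.
elim/pres_ind: g => u; elim/pres_ind: h => v.
by rewrite -pres_class_cat !pres_act_class foldr_cat.
Qed.

Lemma pres_act_gen i t : pres_act (pres_gen R i) t = f (i, false) t.
Proof. exact: pres_act_class. Qed.

Lemma pres_act_genV i t : pres_act (pres_gen R i)^-1 t = f (i, true) t.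
Proof. by rewrite pres_gen_inv pres_act_class. Qed.

End Action.

Section Morphism.
Context {H : groupType}.
Variable x : I -> H.

Let letter (l : I * bool) (h : H) := (if l.2 then (x l.1)^-1 else x l.1) * h.

Hypothesis xR : forall u v, R u v -> foldr letter 1 u = foldr letter 1 v.

Let letterK i e h : letter (i, e) (letter (i, ~~ e) h) = h.
Proof. by case: e; rewrite /letter /= ?mulKg ?mulVKg. Qed.

Let foldr_letter u h : foldr letter h u = foldr letter 1 u * h.
Proof. by elim: u => [|l u /= ->]; rewrite ?mul1g // /letter mulgA. Qed.

Let letterR u v : R u v -> forall h, foldr letter h u = foldr letter h v.
Proof. by move=> uv h; rewrite foldr_letter (xR _ _ uv) -foldr_letter. Qed.

(** Letters act on [H] by left multiplication; the image of [g] is the point to which [g] sends the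
    identity. *)
Lemma pres_morphism :
  exists phi : {multiplicative presented R -> H},
    forall i, phi (pres_gen R i) = x i.
Proof.
pose phi g := pres_act letter g 1.
have phiE g h : pres_act letter g h = phi g * h by exact: foldr_letter.
have phiM : {morph phi : g h / g * h}.
  by move=> g h; rewrite {1}/phi pres_actM // phiE.
pose phim := isMultiplicative.Build _ _ phi phiM.
pose psi : {multiplicative presented R -> H} := HB.pack phi phim.
exists psi => i /=.
by rewrite /phi pres_act_gen // /letter mulg1.
Qed.

End Morphism.

End PresentedGroups.

(** * Morphisms, units, inverses and powers *)

Section Multiplicative.
Context {G H : groupType}.
Variable f : {multiplicative G -> H}.

Lemma multiplicative1 : f 1 = 1.
Proof. by apply: (@mulgI _ (f 1)); rewrite -gmulfM !mulg1. Qed.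

Lemma multiplicativeV g : f g^-1 = (f g)^-1.
Proof. by apply: (@mulgI _ (f g)); rewrite -gmulfM !mulgV multiplicative1. Qed.

Lemma multiplicativeX g n : f (g ^+ n) = f g ^+ n.
Proof.
by elim: n => [|n IHn]; rewrite ?multiplicative1 // !expgS gmulfM IHn.
Qed.

Lemma multiplicative_zpow g n : f (zpow g n) = zpow (f g) n.
Proof. by case: n => n /=; rewrite ?multiplicativeV multiplicativeX. Qed.

End Multiplicative.

(** * Integer powers and cyclic subgroups *)

Section IntegerPowers.
Context {G : groupType}.
Implicit Types (x : G) (m n : int).

Lemma zpow0 x : zpow x 0 = 1. Proof. by []. Qed.

Lemma zpow1 x : zpow x 1 = x. Proof. by []. Qed.

Lemma zpow_add1 x n : zpow x (1 + n)%R = x * zpow x n.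
Proof.
case: n => [n|[|n]]; first by rewrite /= -expgS.
  by rewrite /= mulgV.
have -> : (1 + Negz n.+1 = Negz n)%R by lia.
by rewrite /= [x ^+ n.+2]expgSr invgM mulVKg.
Qed.

Lemma zpow_sub1 x n : zpow x (n - 1)%R = x^-1 * zpow x n.
Proof.
by rewrite -{2}[n](GRing.subrKC 1%R) zpow_add1 mulKg.
Qed.

Lemma zpowD x m n : zpow x (m + n)%R = zpow x m * zpow x n.
Proof.
elim/int_rect: m => [|m IHm|m IHm]; first by rewrite GRing.add0r zpow0 mul1g.
  rewrite -add1n PoszD -GRing.addrA !zpow_add1 IHm.
  by rewrite mulgA.
have -> : (- (m.+1)%:Z + n = (- m%:Z + n) - 1)%R by lia.
have -> : (- (m.+1)%:Z = - m%:Z - 1)%R by lia.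
by rewrite !zpow_sub1 IHm mulgA.
Qed.

Lemma zpowN x n : zpow x (- n)%R = (zpow x n)^-1.
Proof. by apply: (@mulgI _ (zpow x n)); rewrite -zpowD GRing.subrr mulgV. Qed.

Lemma zpowV x n : zpow x^-1 n = zpow x (- n)%R.
Proof. by rewrite zpowN; case: n => n /=; rewrite expVgn. Qed.

Lemma cyclic_subM x g h :
  cyclic_sub x g -> cyclic_sub x h -> cyclic_sub x (g * h).
Proof. by move=> [m ->] [n ->]; exists (m + n)%R; rewrite zpowD. Qed.

Lemma cyclic_subV x g : cyclic_sub x g -> cyclic_sub x g^-1.
Proof. by move=> [m ->]; exists (- m)%R; rewrite zpowN. Qed.

End IntegerPowers.

(** * Left-orderings from positive cones *)

Section Cones.
Context {G : groupType}.
Implicit Type P : set G.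

Lemma positive_cone_order_of_cone P :
  ~ P 1 -> positive_cone (order_of_cone P) = P.
Proof.
move=> P1; apply/seteqP; split=> g.
  by case=> -[//|]; rewrite invg1 mul1g.
move=> Pg; split; last by move=> g1; rewrite -g1 in Pg.
by right; rewrite invg1 mul1g.
Qed.

Lemma order_of_cone_left_ordering P : ~ P 1 ->
    (forall g h, P g -> P h -> P (g * h)) ->
    (forall g, [\/ P g, g = 1 | P g^-1]) ->
  left_ordering_with_cone (order_of_cone P) P.
Proof.
move=> P1 PM PT; split; last exact: positive_cone_order_of_cone.
split=> [g|g h|g h k|g h|f g h].
- by left.
- case=> // Pgh [//|Phg]; case: P1.
  by rewrite -(mulVg g) -{2}[g](mulVKg h) mulgA; apply: PM.
- case=> [->//|Pgh] [<-|Phk]; right=> //.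
  by rewrite -[k](mulVKg h) mulgA; apply: PM.
- case: (PT (g^-1 * h)) => [|/mulg1_eq|]; first by left; right.
    by rewrite invgK; left; left.
  by rewrite invgM invgK; right; right.
- case=> [->|Pgh]; [by left | right].
  by rewrite invgM -mulgA mulKg.
Qed.

End Cones.

(** * 1-positivity in an arbitrary group *)

Section OnePositive.
Context {G : groupType}.

(** Words in [x] and integer powers of [y] with at least one [x], stated over any group so that
    morphisms and substitutions can be followed by induction. *)
Inductive one_pos (x y : G) : set G :=
| OP_gen n : one_pos x y (x * zpow y n)
| OP_genM g : one_pos x y g -> one_pos x y (x * g)
| OP_powM n g : one_pos x y g -> one_pos x y (zpow y n * g).

Variables x y : G.

Lemma one_posM g h : one_pos x y g -> one_pos x y h -> one_pos x y (g * h).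
Proof.
move=> Pg Ph; elim: Pg => [n|{}g _ IH|n {}g _ IH]; rewrite -mulgA.
- exact/OP_genM/OP_powM.
- exact/OP_genM.
- exact/OP_powM.
Qed.

Lemma one_pos_gen : one_pos x y x.
Proof. by rewrite -[X in one_pos _ _ X]mulg1 -(zpow0 y); apply: OP_gen. Qed.

Lemma one_pos_mulr_pow n g : one_pos x y g -> one_pos x y (g * zpow y n).
Proof.
elim=> [m|{}g _ IH|m {}g _ IH]; rewrite -mulgA.
- by rewrite -zpowD; apply: OP_gen.
- exact: OP_genM.
- exact: OP_powM.
Qed.

(** Each [x] is rewritten as [(x * y) * y^-1], which brings in no inverse of the new first generator
    [x * y]. *)
Lemma one_pos_mulV g : one_pos x y g -> one_pos (x * y) y^-1 g.
Proof.
have xE h : x * h = x * y * (zpow y^-1 1 * h) by rewrite zpow1 mulgA mulgK.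
have powE n : zpow y n = zpow y^-1 (- n)%R by rewrite zpowV GRing.opprK.
elim=> [n|{}g _ IH|n {}g _ IH].
- by rewrite (xE (zpow y n)) powE -zpowD; apply: OP_gen.
- by rewrite (xE g); apply/OP_genM/OP_powM.
- by rewrite powE; apply: OP_powM.
Qed.

End OnePositive.

(** The substitution is an involution: [x * y * y^-1 = x]. *)
Lemma one_posV_mul (G : groupType) (x y g : G) :
  one_pos (x * y) y^-1 g -> one_pos x y g.
Proof. by move/one_pos_mulV; rewrite mulgK invgK. Qed.

Lemma one_pos_morph (G H : groupType) (f : {multiplicative G -> H}) x y g :
  one_pos x y g -> one_pos (f x) (f y) (f g).
Proof.
elim=> [n|{}g _ IH|n {}g _ IH]; rewrite gmulfM ?multiplicative_zpow.
- exact: OP_gen.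
- exact: OP_genM.
- exact: OP_powM.
Qed.

Lemma one_positiveE : one_positive = one_pos sigma1 sigma2.
Proof.
apply/seteqP; split=> g.
  case=> n0 [ns [+ ->]]; move=> ns0; apply: OP_powM.
  elim: ns ns0 => // n [|m ns] IHns _; rewrite big_cons.
    by rewrite big_nil mulg1; apply: OP_gen.
  by rewrite -mulgA; apply/OP_genM/OP_powM/IHns.
elim=> [n|{}g _ [n0 [ns [_ ->]]]|m {}g _ [n0 [ns [ns0 ->]]]].
- by exists 0%R, [:: n]; split=> //; rewrite big_seq1 zpow0 mul1g.
- by exists 0%R, (n0 :: ns); split=> //; rewrite big_cons zpow0 mul1g mulgA.
- by exists (m + n0)%R, ns; split=> //; rewrite zpowD mulgA.
Qed.

(** * The two defining relations under [(x, y) |-> (x * y, y^-1)] *)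

Section TwoPresentations.
Context {G : groupType}.
Variables x y : G.

Lemma braid_of_Gamma2 : y * (x * (x * y)) = x ->
  x * y * (y^-1 * (x * y)) = y^-1 * (x * y * y^-1).
Proof. by move=> xy; rewrite -mulgA mulVKg mulgK -{3}xy mulKg. Qed.

Lemma Gamma2_of_braid : x * (y * x) = y * (x * y) ->
  y^-1 * (x * y * (x * y * y^-1)) = x * y.
Proof. by move=> xy; rewrite mulgK -mulgA xy mulKg. Qed.

End TwoPresentations.

(** * The universal cover of the rational projective line *)

Section CircleCover.
Import Order.TTheory GRing.Theory Num.Theory.
Local Open Scope ring_scope.

(* The point [(n, None)] of the universal cover is the lift of infinity that
   begins the [n]-th sheet. The generator [b] is a lift of [x |-> x - 1] and [a]
   is a lift of the order-three map [x |-> 1 / (1 - x)] that moves every point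
   up. *)
Definition cover : Type := (int * option rat)%type.

(** The sheet number grows when the move reaches or passes infinity: [x = 1] lands on infinity, and
    [x > 1] on a negative number of the next sheet. *)
Definition cover_a (t : cover) : cover :=
  match t with
  | (n, None) => (n, Some 0)
  | (n, Some x) =>
    if x == 1 then (n + 1, None) else (n + (1 < x)%R%:Z, Some (1 - x)^-1)
  end.

Definition cover_aV (t : cover) : cover :=
  match t with
  | (n, None) => (n - 1, Some 1)
  | (n, Some y) =>
    if y == 0 then (n, None) else (n - (y < 0)%R%:Z, Some (1 - y^-1))
  end.

Definition cover_shift (d : rat) (t : cover) : cover :=
  (t.1, omap (fun x => x + d) t.2).

Definition cover_letter (l : bool * bool) : cover -> cover :=
  match l with
  | (true, false) => cover_a
  | (true, true) => cover_aV
  | (false, false) => cover_shift (-1)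
  | (false, true) => cover_shift 1
  end.

Lemma cover_aK : cancel cover_a cover_aV.
Proof.
case=> n [x|] //=; case: eqP => [->|/eqP x1] /=; first by rewrite addrK.
have x1' : 1 - x != 0 by rewrite subr_eq0 eq_sym.
by rewrite invr_eq0 (negPf x1') invr_lt0 subr_lt0 addrK invrK subKr.
Qed.

Lemma cover_aVK : cancel cover_aV cover_a.
Proof.
case=> n [y|] /=; last by rewrite subrK.
case: eqP => [->|/eqP y0] //=.
have -> : (1 - y^-1 == 1) = false.
  by rewrite -subr_eq0 addrC addKr oppr_eq0 invr_eq0 (negPf y0).
by rewrite ltrBrDr gtrDl invr_lt0 subrK subKr invrK.
Qed.

Lemma cover_letterK i e t :
  cover_letter (i, e) (cover_letter (i, ~~ e) t) = t.
Proof.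
case: i e => [] [] /=; rewrite ?cover_aK ?cover_aVK //;
  by case: t => n [x|] //; rewrite /cover_shift /= ?subrK ?addrK.
Qed.

Lemma cover_letter_rel u v : Gamma2_rel u v ->
  forall t, foldr cover_letter t u = foldr cover_letter t v.
Proof.
case=> -> -> [n [x|]] //=; last by rewrite addr0.
(* In [b a^2 b], the [a] applied first reaches infinity at [x = 2], the other one at [x = 1]; these
   points are treated apart. *)
have -> : (x - 1 == 1) = (x == 2%:R) by rewrite subr_eq.
have [->|x2] /= := eqVneq x 2%:R; first by rewrite /cover_shift /=.
have x2' : 1 - (x - 1) != 0 by apply: contra_neq x2 => x2; lra.
have [->|x1] /= := eqVneq x 1.
  by rewrite addr0.
have -> : ((1 - (x - 1))^-1 == 1) = false.
  by apply/negbTE; rewrite invr_eq1; apply: contra_neq x1 => x1; lra.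
rewrite /cover_shift /=; congr (_, Some _); last first.
  by field; rewrite x2' subr_eq0 eq_sym x1.
(* Sheets are counted: the first [a] passes infinity iff [x > 2], the second iff [1 < x < 2], so
   together once iff [x > 1], as on the right side. *)
have [x_lt2|x_ge2] := ltP x 2%:R.
  rewrite invf_gt1; last by lra.
  have -> : (1 < x - 1) = false by apply: le_gtF; lra.
  have -> : (1 - (x - 1) < 1) = (1 < x) by apply/idP/idP => ?; lra.
  by rewrite addr0.
have x_gt2 : 2%:R < x by rewrite lt_neqAle eq_sym x2.
have y_lt0 : (1 - (x - 1))^-1 < 0 by rewrite invr_lt0; lra.
have -> : (1 < x - 1) = true by lra.
have -> : (1 < x) = true by lra.
have -> : (1 < (1 - (x - 1))^-1) = false by apply: le_gtF; lra.
by rewrite addr0.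
Qed.

(** On sheet 0, infinity is the base point itself and every finite point lies strictly above it. *)
Definition above_base (t : cover) : bool :=
  if t.2 is Some _ then 0 <= t.1 else 0 < t.1.

Lemma above_base_a t : t = (0, None) \/ above_base t -> above_base (cover_a t).
Proof.
case: t => n [x|] /= [[//]|]; rewrite /above_base //=; last exact: ltW.
- by case: ifP => _ /= n0; lia.
- by move=> ->.
Qed.

Lemma above_base_shift d t : above_base (cover_shift d t) = above_base t.
Proof. by case: t => n []. Qed.

End CircleCover.

(** * The action of [Gamma2] on the cover and 1-positivity *)

Definition gamma_act : Gamma2 -> cover -> cover := pres_act cover_letter.

Definition base : cover := (0%R, None).

Lemma gamma_act1 t : gamma_act 1 t = t.
Proof. exact: (pres_act1 _ cover_letterK cover_letter_rel). Qed.

Lemma gamma_actM g h t : gamma_act (g * h) t = gamma_act g (gamma_act h t).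
Proof. exact: (pres_actM _ cover_letterK cover_letter_rel). Qed.

Lemma gamma_act_a t : gamma_act a t = cover_a t.
Proof. exact: (pres_act_gen _ cover_letterK cover_letter_rel true). Qed.

Lemma gamma_act_zpow_b n t :
  gamma_act (zpow b n) t = cover_shift (- n%:~R)%R t.
Proof.
elim/int_rect: n t => [|n IHn|n IHn] [k o].
- rewrite gamma_act1 /cover_shift; congr (_, _); case: o => //= x.
  by rewrite GRing.addr0.
- rewrite -add1n PoszD zpow_add1 gamma_actM IHn.
  rewrite [gamma_act b _](pres_act_gen _ cover_letterK cover_letter_rel false).
  rewrite /cover_shift /=; congr (_, _); case: o => //= x; congr Some.
  by rewrite GRing.rmorphD /= GRing.opprD -GRing.addrA [(-1 - _)%R]GRing.addrC.
- have -> : (- n.+1%:Z = - n%:Z - 1)%R by lia.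
  rewrite zpow_sub1 gamma_actM IHn.
  rewrite [gamma_act b^-1 _]
    (pres_act_genV _ cover_letterK cover_letter_rel false).
  rewrite /cover_shift /=; congr (_, _); case: o => //= x; congr Some.
  by rewrite GRing.rmorphB /= GRing.opprB -GRing.addrA [(1 - _)%R]GRing.addrC.
Qed.

Lemma gamma_act_zpow_b_base n : gamma_act (zpow b n) base = base.
Proof. by rewrite gamma_act_zpow_b. Qed.

Lemma above_base_zpow_b n t :
  above_base (gamma_act (zpow b n) t) = above_base t.
Proof. by rewrite gamma_act_zpow_b above_base_shift. Qed.

Lemma one_pos_above_base g : one_pos a b g -> above_base (gamma_act g base).
Proof.
elim=> [n|{}g _ IH|n {}g _ IH]; rewrite gamma_actM.
- by rewrite gamma_act_zpow_b_base gamma_act_a.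
- by rewrite gamma_act_a; apply: above_base_a; right.
- by rewrite above_base_zpow_b.
Qed.

Lemma one_pos_notin_b g : one_pos a b g -> ~ cyclic_sub b g.
Proof.
by move=> /one_pos_above_base + [n gE]; rewrite gE gamma_act_zpow_b_base.
Qed.

Lemma one_pos_neq1 : ~ one_pos a b 1.
Proof. by move/one_pos_notin_b; apply; exists 0%R. Qed.

Lemma expb_neq1 n : (0 < n)%N -> b ^+ n <> 1.
Proof.
(* All powers of [b] fix the base point, so they are told apart at a finite point. *)
move=> n0 bn; have := gamma_act_zpow_b n (0%R, Some 0%R).
rewrite [zpow _ _]bn gamma_act1 => -[] /eqP.
by rewrite GRing.add0r eq_sym GRing.oppr_eq0 intr_eq0; case: n n0 {bn}.
Qed.

(** * The central element, normal forms and trichotomy *)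

Local Notation P := (semigroup_gen [set a; b]).

Lemma Gamma2_relation : b * (a * (a * b)) = a.
Proof.
transitivity (pres_class Gamma2_rel ([:: (false, false)] ++
    ([:: (true, false)] ++ ([:: (true, false)] ++ [:: (false, false)])))).
  by rewrite !pres_class_cat.
by apply/pres_classP; apply: WC_rel.
Qed.

Lemma B3_relation : sigma1 * (sigma2 * sigma1) = sigma2 * (sigma1 * sigma2).
Proof.
transitivity (pres_class B3_rel
    ([:: (true, false)] ++ ([:: (false, false)] ++ [:: (true, false)]))).
  by rewrite !pres_class_cat.
transitivity (pres_class B3_rel
    ([:: (false, false)] ++ ([:: (true, false)] ++ [:: (false, false)]))).
  by apply/pres_classP; apply: WC_rel.
by rewrite !pres_class_cat.
Qed.

Lemma Gamma2_ind (Q : Gamma2 -> Prop) : Q 1 ->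
    (forall g, Q g -> Q (a * g)) -> (forall g, Q g -> Q (b * g)) ->
    (forall g, Q g -> Q (a^-1 * g)) -> (forall g, Q g -> Q (b^-1 * g)) ->
  forall g, Q g.
Proof.
move=> Q1 Qa Qb QaV QbV; apply: (@pres_gen_ind _ Gamma2_rel) => // -[] g.
- exact: Qa.
- exact: Qb.
- exact: QaV.
- exact: QbV.
Qed.

Lemma positive_a : P a. Proof. by apply: SG_gen; left. Qed.
Lemma positive_b : P b. Proof. by apply: SG_gen; right. Qed.

Definition nonneg (g : Gamma2) := g = 1 \/ P g.

Lemma nonnegM {g h} : nonneg g -> nonneg h -> nonneg (g * h).
Proof.
case=> [->|Pg]; first by rewrite mul1g.
case=> [->|Ph]; first by rewrite mulg1; right.
by right; apply: SG_mul.
Qed.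

Lemma nonnegX {g} n : nonneg g -> nonneg (g ^+ n).
Proof.
move=> Qg; elim: n => [|n IHn]; first by left.
by rewrite expgS; apply: nonnegM.
Qed.

Lemma nonneg_a : nonneg a. Proof. by right; apply: positive_a. Qed.
Lemma nonneg_b : nonneg b. Proof. by right; apply: positive_b. Qed.

(** [a ^+ 3] is a power of [a] and also the square of [a * b * a], and [b] is a product of [a^-1],
    [a * b * a] and [a^-1]. *)
Lemma commute_a3_b : commute (a ^+ 3) b.
Proof.
have aba2 : a ^+ 3 = (a * b * a) ^+ 2.
  by rewrite !expgS expg0 !mulg1 -{2}Gamma2_relation !mulgA.
have bE : b = a^-1 * (a * b * a) * a^-1 by rewrite !mulgA mulVg mul1g mulgK.
rewrite bE; apply: commuteM; first apply: commuteM.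
- exact/commuteV/commute_sym/commuteX.
- by rewrite aba2; apply/commute_sym/commuteX.
- exact/commuteV/commute_sym/commuteX.
Qed.

Lemma commute_a3 g : commute (a ^+ 3) g.
Proof.
have ca : commute (a ^+ 3) a by apply/commute_sym/commuteX.
elim/Gamma2_ind: g => [|g IHg|g IHg|g IHg|g IHg].
  exact: commute1.
all: apply: commuteM => //.
- exact: commute_a3_b.
- exact: commuteV.
- exact/commuteV/commute_a3_b.
Qed.

Lemma commute_a3X n g : commute (a ^+ 3 ^+ n) g.
Proof. exact/commute_sym/commuteX/commute_sym/commute_a3. Qed.

(** Words that begin and end with [b] and in which every [a] stands alone: [a^3] can be moved out,
    and [b a^2 b] collapses to [a]. *)
Inductive reduced : set Gamma2 :=
| Red_b : reduced b
| Red_bM m : reduced m -> reduced (b * m)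
| Red_baM m : reduced m -> reduced (b * (a * m)).

Lemma reduced_nonneg m : reduced m -> nonneg m.
Proof.
elim=> [|{}m _ IH|{}m _ IH]; first exact: nonneg_b.
  by apply: nonnegM nonneg_b _.
by apply: nonnegM nonneg_b (nonnegM nonneg_a _).
Qed.

(* Substituting [b = a^-2 b^-1 a] turns a reduced word [m] into [a^-2 n^-1 a]
   with [n] positive: this is how a negative power of the central element
   [a^3] makes a reduced word negative. *)
Lemma reduced_flip m : reduced m ->
  exists2 n, nonneg n & n * (a * (a * m)) = a.
Proof.
have rel g : b * (a * (a * (b * g))) = a * g.
  by rewrite -[in RHS]Gamma2_relation !mulgA.
elim=> [|{}m _ [n Qn nm]|{}m _ [n Qn nm]].
- by exists b; [exact: nonneg_b | rewrite Gamma2_relation].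
- exists (n * a * b); last by rewrite -!mulgA rel.
  by apply: nonnegM nonneg_b; apply: nonnegM nonneg_a.
- exists (n * b); last by rewrite -!mulgA rel.
  exact: nonnegM nonneg_b.
Qed.

(** The central power multiplies [g], instead of dividing the right side, so that all exponents are
    natural numbers. *)
Definition normal_form (g : Gamma2) : Prop :=
  exists n i, a ^+ 3 ^+ n * g = a ^+ i \/
    exists2 m, reduced m & exists j, a ^+ 3 ^+ n * g = a ^+ i * m * a ^+ j.

Lemma normal_form_aM g : normal_form g -> normal_form (a * g).
Proof.
case=> n [i nf]; exists n, i.+1.
rewrite mulgA (commute_a3X n a) -mulgA.
case: nf => [->|[m mR [j ->]]]; [left | right; exists m => //; exists j].
  by rewrite expgS.
by rewrite !mulgA -expgS.
Qed.

Lemma normal_form_aVM g : normal_form g -> normal_form (a^-1 * g).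
Proof.
(* As [a^-1 = a^-3 a^2], two letters [a] are prepended and [n] grows by one. *)
move=> nf; have [n [i nf2]] := normal_form_aM _ (normal_form_aM _ nf).
exists n.+1, i.
have -> // : a ^+ 3 ^+ n.+1 * (a^-1 * g) = a ^+ 3 ^+ n * (a * (a * g)).
by rewrite expgSr -mulgA mulgA [a ^+ 3]expgSr !mulgA mulgK -!mulgA.
Qed.

(** Only [e = 2] calls for a rewriting: [m] starts with [b], so [b a^2 b = a] applies once, and the
    new [a] may join an [a] that followed in [m]. *)
Lemma reduced_baM e m : (e < 3)%N -> reduced m ->
  exists i, b * (a ^+ e * m) = a ^+ i \/
    exists2 m', reduced m' & b * (a ^+ e * m) = a ^+ i * m'.
Proof.
case: e => [|[|[|//]]] _ mR.
- exists 0%N; right; exists (b * m); first exact: Red_bM.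
  by rewrite !mul1g.
- exists 0%N; right; exists (b * (a * m)); first exact: Red_baM.
  by rewrite mul1g.
- rewrite expg2; case: mR => [|{}m mR|{}m mR].
  + by exists 1%N; left; rewrite -mulgA Gamma2_relation.
  + exists 1%N; right; exists m => //.
    by rewrite expg1 -{3}Gamma2_relation !mulgA.
  + exists 2%N; right; exists m => //.
    by rewrite expg2 -{4}Gamma2_relation !mulgA.
Qed.

Lemma normal_form_bM g : normal_form g -> normal_form (b * g).
Proof.
case=> n [i nf].
have bg : a ^+ 3 ^+ n * (b * g) = b * (a ^+ 3 ^+ n * g).
  by rewrite mulgA (commute_a3X n b) -mulgA.
case: nf => [nf|[m mR [j nf]]].
  exists n, 0%N; right; exists b; first exact: Red_b.
  by exists i; rewrite bg nf mul1g.
(* Whole cubes in [a ^+ i] pass to the left of the new [b], leaving at most two letters [a] between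
   [b] and [m]. *)
pose q := (i %/ 3)%N.
have aq k : a ^+ (3 * q + k)%N = a ^+ 3 ^+ q * a ^+ k by rewrite expgnDr expgnA.
have iE : a ^+ i = a ^+ 3 ^+ q * a ^+ (i %% 3)%N.
  by rewrite -aq /q mulnC -divn_eq.
have {}bg : a ^+ 3 ^+ n * (b * g) =
    a ^+ 3 ^+ q * (b * (a ^+ (i %% 3)%N * m)) * a ^+ j.
  by rewrite bg nf iE !mulgA (commute_a3X q b).
have e3 : (i %% 3 < 3)%N by rewrite ltn_pmod.
have [k [red|[m' m'R red]]] := reduced_baM _ m e3 mR.
  exists n, (3 * q + k + j)%N; left.
  by rewrite bg red -aq -expgnDr.
exists n, (3 * q + k)%N; right; exists m' => //; exists j.
by rewrite bg red aq !mulgA.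
Qed.

Lemma normal_formP g : normal_form g.
Proof.
elim/Gamma2_ind: g => [|g IHg|g IHg|g IHg|g IHg].
- by exists 0%N, 0%N; left; rewrite mulg1.
- exact: normal_form_aM.
- exact: normal_form_bM.
- exact: normal_form_aVM.
(* The relation gives [b^-1 = a^-1 b a^2], which reduces this case to the others. *)
- have -> : b^-1 * g = a^-1 * (b * (a * (a * g))).
    apply: (@mulgI _ a).
    by rewrite mulVKg -[in LHS]Gamma2_relation -!mulgA mulVKg.
  exact/normal_form_aVM/normal_form_bM/normal_form_aM/normal_form_aM.
Qed.

Lemma a3X_divide i n g : a ^+ 3 ^+ n * g = a ^+ i ->
  nonneg g \/ nonneg g^-1.
Proof.
move=> gE; have {gE}-> : g = (a ^+ (3 * n)%N)^-1 * a ^+ i.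
  by rewrite -gE expgnA mulKg.
move: (3 * n)%N => k; have [le_i|/ltnW le_i] := leqP k i.
  left; rewrite -[i](subnKC le_i) expgnDr mulKg.
  exact: nonnegX _ nonneg_a.
right; rewrite invgM invgK -[k](subnKC le_i) expgnDr mulKg.
exact: nonnegX _ nonneg_a.
Qed.

Lemma nonneg_total g : nonneg g \/ nonneg g^-1.
Proof.
have [n [i [|[m mR [j]]]]] := normal_formP g; first exact: a3X_divide.
have aX k : a ^+ k = a ^+ 3 ^+ (k %/ 3) * a ^+ (k %% 3)%N.
  by rewrite -expgnA -expgnDr mulnC -divn_eq.
(* The cubes from both ends are collected; the sign of [g] is then decided by comparing [n] with
   [q]. *)
set q := (i %/ 3 + j %/ 3)%N.
have {aX}-> : a ^+ i * m * a ^+ j =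
    a ^+ 3 ^+ q * (a ^+ (i %% 3)%N * m * a ^+ (j %% 3)%N).
  rewrite (aX i) (aX j) -[in LHS]mulgA [m * _]mulgA -(commute_a3X _ m).
  rewrite -!mulgA [a ^+ (i %% 3)%N * (a ^+ 3 ^+ _ * _)]mulgA -commute_a3X.
  by rewrite expgnDr !mulgA.
have : (i %% 3 <= 2)%N by rewrite -ltnS ltn_pmod.
have : (j %% 3 <= 2)%N by rewrite -ltnS ltn_pmod.
move: (i %% 3)%N (j %% 3)%N q => e f q f2 e2 gE.
have Qe k : nonneg (a ^+ k) by apply: nonnegX _ nonneg_a.
have [le_nq|lt_qn] := leqP n q.
  left; suff -> : g = a ^+ 3 ^+ (q - n) * (a ^+ e * m * a ^+ f).
    rewrite -expgnA; apply: nonnegM => //; apply: nonnegM => //.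
    by apply: nonnegM => //; apply: reduced_nonneg.
  apply: (@mulgI _ (a ^+ 3 ^+ n)).
  by rewrite gE [RHS]mulgA -expgnDr subnKC.
right; have [p Qp pm] := reduced_flip _ mR.
(* The inverse of [g]: by [pm], the factor [a^(2-f) p a^(2-e)] times [a^e m a^f] is [a^3], which
   accounts for one of the [n - q] cubes. *)
pose h := a ^+ 3 ^+ (n - q.+1) * (a ^+ (2 - f) * p * a ^+ (2 - e)).
suff hg : h * g = 1.
  rewrite -[g]mul1g -(mulVg h) -mulgA hg mulg1 invgK /h -expgnA.
  by apply: nonnegM => //; apply: nonnegM => //; apply: nonnegM.
have {}gE : a ^+ 3 ^+ (n - q) * g = a ^+ e * m * a ^+ f.
  apply: (@mulgI _ (a ^+ 3 ^+ q)).
  by rewrite -gE mulgA -expgnDr subnKC // ltnW.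
apply: (@mulgI _ (a ^+ 3 ^+ (n - q))).
rewrite mulgA (commute_a3X _ h) -mulgA gE mulg1 /h -mulgA.
have -> : a ^+ (2 - f) * p * a ^+ (2 - e) * (a ^+ e * m * a ^+ f) = a ^+ 3.
  have -> : a ^+ (2 - f) * p * a ^+ (2 - e) * (a ^+ e * m * a ^+ f) =
      a ^+ (2 - f) * (p * (a ^+ (2 - e) * a ^+ e * m)) * a ^+ f.
    by rewrite !mulgA.
  rewrite -expgnDr subnK // expg2 -[a * a * m]mulgA pm -expgSr.
  by rewrite -expgnDr addSn subnK.
by rewrite -expgSr subnSK.
Qed.

(** * Positive elements compared with 1-positive ones *)

Lemma positive_cases g :
  P g -> one_pos a b g \/ exists2 n, (0 < n)%N & g = b ^+ n.
Proof.
have bX n h : one_pos a b h -> one_pos a b (b ^+ n * h).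
  exact: (OP_powM a b (Posz n)).
elim=> [{}g [->|->]|{}g h _ [Og|[n n0 ->]] _ [Oh|[m m0 ->]]].
- by left; apply: one_pos_gen.
- by right; exists 1%N.
- by left; apply: one_posM.
- by left; apply: (one_pos_mulr_pow a b (Posz m)).
- by left; apply: bX.
- by right; exists (n + m)%N; [rewrite addn_gt0 n0 | rewrite expgnDr].
Qed.

Lemma positive_cyclic g :
  P g -> cyclic_sub b g -> exists2 n, (0 < n)%N & g = b ^+ n.
Proof. by case/positive_cases=> // /one_pos_notin_b. Qed.

Lemma positive_expb n : (0 < n)%N -> P (b ^+ n).
Proof.
by move=> n0; case: (nonnegX n nonneg_b) => // /expb_neq1 => /(_ n0).
Qed.

Lemma positive_neq1 : ~ P 1.
Proof.
case/positive_cases=> [/one_pos_neq1 //|[n n0 /esym]]; exact: expb_neq1.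
Qed.

Lemma positive_total g : [\/ P g, g = 1 | P g^-1].
Proof.
case: (nonneg_total g) => [[->|Pg]|[gV1|PgV]]; first by constructor 2.
- by constructor 1.
- by constructor 2; rewrite -[g]invgK gV1 invg1.
- by constructor 3.
Qed.

(** A 1-positive [g] may be written with [b^-1], so [P g] comes from trichotomy: otherwise [g] is
    the identity, or [g^-1] is 1-positive and so is [g * g^-1 = 1], or [g] is a power of [b]. *)
Lemma one_posE : one_pos a b = P `\` cyclic_sub b.
Proof.
apply/seteqP; split=> g; last first.
  by case=> /positive_cases [//|[n _ ->]] []; exists (Posz n).
move=> Og; split; last exact: one_pos_notin_b.
case: (positive_total g) => [//|g1|/positive_cases [OgV|[n _ gV]]].
- by rewrite g1 in Og; case: one_pos_neq1.
- by case: one_pos_neq1; rewrite -(mulgV g); apply: one_posM.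
- case: (one_pos_notin_b _ Og); rewrite -[g]invgK gV.
  by apply: cyclic_subV; exists (Posz n).
Qed.

(** * The two orderings on [Gamma2] *)

Lemma left_ordering_preceq2 : left_ordering_with_cone preceq2 P.
Proof.
apply: order_of_cone_left_ordering positive_total; first exact: positive_neq1.
by move=> g h; apply: SG_mul.
Qed.

Lemma convex_cyclic_b : convex preceq2 (cyclic_sub b).
Proof.
move=> h1 g h2 bh1 bh2 [] [// | P1 _] [] [//|P2 _].
rewrite -(mulVKg h1 g); apply: cyclic_subM => //.
case/positive_cases: P1 => [O1|[n _ ->]]; last by exists (Posz n).
(* The product is [h1^-1 * h2], a power of [b], and so cannot be 1-positive. *)
have O12 : one_pos a b (h1^-1 * g * (g^-1 * h2)).
  case/positive_cases: P2 => [O2|[n _ ->]]; first exact: one_posM.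
  exact: (one_pos_mulr_pow a b (Posz n)).
case: (one_pos_notin_b _ O12); rewrite mulgA mulgK.
by apply: cyclic_subM => //; apply: cyclic_subV.
Qed.

Lemma preceq2'_coneE : preceq2'_cone =
  [set g | exists2 r, (1 <= r)%N & g = b ^- r] `|` one_pos a b.
Proof. by rewrite one_posE. Qed.

Lemma preceq2'E : preceq2' = order_of_cone preceq2'_cone.
Proof.
rewrite /preceq2' /extension; congr order_of_cone.
have [_ ->] := left_ordering_preceq2; congr (_ `|` _).
have revV g : strict preceq2 g 1 <-> P g^-1.
  split=> [[[g1 []//|]]|PgV]; first by rewrite mulg1.
  split; first by right; rewrite mulg1.
  by move=> g1; apply: positive_neq1; rewrite -invg1 -g1.
rewrite positive_cone_order_of_cone; last first.
  by move/revV; rewrite invg1; apply: positive_neq1.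
apply/seteqP; split=> g /=.
  case=> /revV PgV /cyclic_subV bgV.
  have [n n0 gV] := positive_cyclic _ PgV bgV.
  by exists n => //; rewrite -gV invgK.
case=> n n0 ->; split; first by apply/revV; rewrite invgK; apply: positive_expb.
by apply: cyclic_subV; exists (Posz n).
Qed.

Lemma preceq2'_cone_neq1 : ~ preceq2'_cone 1.
Proof.
rewrite preceq2'_coneE => -[[r r0 /esym br]|/one_pos_neq1 //].
by apply: (expb_neq1 r r0); apply: invg_inj; rewrite br invg1.
Qed.

Lemma preceq2'_coneM g h :
  preceq2'_cone g -> preceq2'_cone h -> preceq2'_cone (g * h).
Proof.
have bV n : b ^- n = zpow b (- n%:Z)%R by rewrite zpowN.
rewrite preceq2'_coneE => -[[r r0 ->]|Og] [[s s0 ->]|Oh].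
- by left; exists (s + r)%N; [rewrite addn_gt0 s0 | rewrite expgnDr invgM].
- by right; rewrite bV; apply: OP_powM.
- by right; rewrite bV; apply: one_pos_mulr_pow.
- by right; apply: one_posM.
Qed.

(** Trichotomy is inherited from [P]: only nontrivial powers of [b] change sign. *)
Lemma preceq2'_cone_total g :
  [\/ preceq2'_cone g, g = 1 | preceq2'_cone g^-1].
Proof.
rewrite preceq2'_coneE.
case: (positive_total g) => [/positive_cases| |/positive_cases].
- case=> [Og|[n n0 ->]]; first by constructor 1; right.
  by constructor 3; left; exists n.
- by constructor 2.
- case=> [Og|[n n0 gV]]; first by constructor 3; right.
  by constructor 1; left; exists n => //; rewrite -gV invgK.
Qed.

Lemma left_ordering_preceq2' : left_ordering_with_cone preceq2' preceq2'_cone.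
Proof.
rewrite preceq2'E; apply: order_of_cone_left_ordering preceq2'_cone_total.
  exact: preceq2'_cone_neq1.
exact: preceq2'_coneM.
Qed.

(** * The isomorphism with [B3] and the comparison of cones *)

Lemma Gamma2_to_B3 : exists phi : {multiplicative Gamma2 -> B3},
  phi a = sigma1 * sigma2 /\ phi b = sigma2^-1.
Proof.
have [|phi phiE] := @pres_morphism _ Gamma2_rel B3
    (fun i => if i then sigma1 * sigma2 else sigma2^-1).
  move=> u v [-> ->] /=; rewrite !mulg1.
  exact: Gamma2_of_braid B3_relation.
by exists phi; split; apply: phiE.
Qed.

Lemma B3_to_Gamma2 : exists psi : {multiplicative B3 -> Gamma2},
  psi sigma1 = a * b /\ psi sigma2 = b^-1.
Proof.
have [|psi psiE] := @pres_morphism _ B3_rel Gamma2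
    (fun i => if i then a * b else b^-1).
  move=> u v [-> ->] /=; rewrite !mulg1.
  exact: braid_of_Gamma2 Gamma2_relation.
by exists psi; split; apply: psiE.
Qed.

Theorem mainTheorem2 :
  (left_ordering_with_cone preceq2 (semigroup_gen [set a; b]) /\
   convex preceq2 (cyclic_sub b) /\
   left_ordering_with_cone preceq2' preceq2'_cone /\
   left_ordering_with_cone preceqD D_positive) /\
  exists phi : {multiplicative Gamma2 -> B3},
    [/\ bijective phi, phi a = sigma1 * sigma2, phi b = sigma2^-1 &
        forall g h : Gamma2, preceq2' g h <-> preceqD (phi g) (phi h)].
Proof.
have [phi [phia phib]] := Gamma2_to_B3.
have [psi [psi1 psi2]] := B3_to_Gamma2.
have phiK : cancel phi psi.
  elim/Gamma2_ind=> [|g IHg|g IHg|g IHg|g IHg];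
    rewrite ?multiplicative1 // !gmulfM IHg; congr (_ * _).
  - by rewrite phia gmulfM psi1 psi2 mulgK.
  - by rewrite phib multiplicativeV psi2 invgK.
  - by rewrite !multiplicativeV phia gmulfM psi1 psi2 mulgK.
  - by rewrite !multiplicativeV phib multiplicativeV psi2 invgK.
have psiK : cancel psi phi.
  apply: (@pres_gen_ind _ B3_rel) => [|[] g IHg|[] g IHg];
    rewrite ?multiplicative1 // !gmulfM IHg; congr (_ * _).
  - by rewrite psi1 gmulfM phia phib mulgK.
  - by rewrite psi2 multiplicativeV phib invgK.
  - by rewrite !multiplicativeV psi1 gmulfM phia phib mulgK.
  - by rewrite !multiplicativeV psi2 multiplicativeV phib invgK.
have cone_phi g : preceq2'_cone g -> D_positive (phi g).
  rewrite preceq2'_coneE /D_positive one_positiveE => -[[r r0 ->]|].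
    right; exists r => //.
    by rewrite multiplicativeV multiplicativeX phib expVgn invgK.
  (* The image is 1-positive for the pair [(sigma1 * sigma2, sigma2^-1)], hence for
     [(sigma1, sigma2)] by the involution. *)
  move/(one_pos_morph _ _ phi); rewrite phia phib => Og; left.
  exact: one_posV_mul.
have cone_psi g : D_positive g -> preceq2'_cone (psi g).
  rewrite preceq2'_coneE /D_positive one_positiveE => -[|[r r0 ->]].
    move/(one_pos_morph _ _ psi); rewrite psi1 psi2 => Og; right.
    exact: one_posV_mul.
  by left; exists r => //; rewrite multiplicativeX psi2 expVgn.
have coneE g : preceq2'_cone g <-> D_positive (phi g).
  by split=> [/cone_phi|/cone_psi] //; rewrite phiK.
split.
  split; first exact: left_ordering_preceq2.
  split; first exact: convex_cyclic_b.
  split; first exact: left_ordering_preceq2'.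
  (* The cone axioms for [D_positive] are carried over from [preceq2'_cone] along [phi] and
     [psi]. *)
  apply: order_of_cone_left_ordering => [|g h Dg Dh|g].
  - by move/cone_psi; rewrite multiplicative1; apply: preceq2'_cone_neq1.
  - rewrite -[g]psiK -[h]psiK -gmulfM; apply: cone_phi.
    by apply: preceq2'_coneM; apply: cone_psi.
  - rewrite -[g]psiK; case: (preceq2'_cone_total (psi g)).
    + by move=> ?; constructor 1; apply: cone_phi.
    + by move=> ->; constructor 2; rewrite multiplicative1.
    + by move=> ?; constructor 3; rewrite -multiplicativeV; apply: cone_phi.
exists phi; split=> //; first by exists psi.
move=> g h; rewrite preceq2'E; split.
  case=> [->|/cone_phi]; first by left.
  by right; rewrite -multiplicativeV -gmulfM.
case=> [/(can_inj phiK) ->|]; first by left.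
by rewrite -multiplicativeV -gmulfM => /coneE; right.
Qed.
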